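(* Let $$\mathbb{Z}^{r_1}\xrightarrow{h_1}\mathbb{Z}^{r_2}\xrightarrow{h_2}\cdots\ \mathbb{Z}^{r_i}\xrightarrow{h_i}\cdots \qquad\text{and}\qquad \mathbb{Z}^{s_1}\xrightarrow{l_1}\mathbb{Z}^{s_2}\xrightarrow{l_2}\cdots\ \mathbb{Z}^{s_k}\xrightarrow{l_k}\cdots$$ be two sequences of simplicial groups and order-preserving group homomorphisms. Then the two sequences have isomorphic colimit dimension groups if, and only if, they are confluent.
   Context: $\mathbb{N}=\{1,2,3,\ldots\}$. A partially ordered Abelian group is an (additively written) Abelian group $G$ with a partial order that is translation-invariant: $x\leqslant y$ implies $x+t\leqslant y+t$ for all $x,y,t\in G$. Morphisms are order-preserving group homomorphisms. The positive cone is $G^+=\{x\in G\mid x\geqslant 0\}$. $G$ is directed if it is generated as a group by $G^+$; unperforated if $nx\geqslant 0$ for some $x\in G$ and $n\in\mathbb{N}$ implies $x\geqslant 0$; and has interpolation if whenever $x_1,x_2,y_1,y_2\in G$ satisfy $x_i\leqslant y_j$ for all $i,j\in\{1,2\}$, there is $z\in G$ with $x_i\leqslant z\leqslant y_j$ for all $i,j$. A dimension group is a partially ordered Abelian group that is directed, unperforated, and has interpolation. The category of dimension groups is the full subcategory of the category of partially ordered Abelian groups whose objects are the dimension groups. A simplicial group is (any partially ordered Abelian group isomorphic to) $\mathbb{Z}^r$, $r\geqslant 0$, with positive cone $(\mathbb{Z}^r)^+=\{(z_1,\ldots,z_r)\mid z_i\geqslant 0 \text{ for all } i\}$; it is a dimension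 group. The colimit dimension group of a sequence is its colimit in the category of dimension groups; it exists, and is the colimit $D$ of the underlying Abelian groups, with colimit maps $\overline{h}_i\colon\mathbb{Z}^{r_i}\to D$, equipped with the positive cone $D^+=\bigcup_{i\in\mathbb{N}}\overline{h}_i((\mathbb{Z}^{r_i})^+)$. Isomorphism means isomorphism in the category of dimension groups. Confluence (in the category of dimension groups). Write a sequence as $(A_i,a_i)_{i\in\mathbb{N}}$ with $a_i\colon A_i\to A_{i+1}$; for $i<j$ put $a_{ij}:=a_{j-1}\circ\cdots\circ a_i\colon A_i\to A_j$. Two sequences $(A_i,a_i)_{i\in\mathbb{N}}$ and $(B_k,b_k)_{k\in\mathbb{N}}$ are confluent if there exist integers $0<i_1<i_2<\cdots$ and $0<k_1<k_2<\cdots$, together with order-preserving group homomorphisms $f_n\colon A_{i_n}\to B_{k_n}$ and $g_n\colon B_{k_n}\to A_{i_{n+1}}$ for each $n\in\mathbb{N}$, such that $a_{i_n i_{n+1}}=g_n\circ f_n$ and $b_{k_n k_{n+1}}=f_{n+1}\circ g_n$ for all $n\in\mathbb{N}$. *)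

(* Defs.v *)
From HB Require Import structures.
From mathcomp Require Import all_boot all_order all_algebra.

Set Implicit Arguments.
Unset Strict Implicit.
Unset Printing Implicit Defensive.

Import Order.TTheory GRing.Theory Num.Theory.

Local Open Scope ring_scope.

(* [porderZmodType] by itself does not relate the order to the addition. *)
HB.mixin Record POrderedZmodule_isPOGroup G of Num.POrderedZmodule G := {
  pog_translate : forall x y t : G, x <= y -> x + t <= y + t
}.

#[short(type="poGroupType")]
HB.structure Definition POGroup :=
  { G of POrderedZmodule_isPOGroup G & Num.POrderedZmodule G }.

#[short(type="poGroupMorphism")]
HB.structure Definition POGroupMorphism (G H : poGroupType) :=
  { f of GRing.isNmodMorphism G H f
       & Order.isOrderMorphism ring_display G ring_display H f }.

Notation "{ 'pogmorphism' G -> H }" := (@poGroupMorphism G%type H%type)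
  (at level 0, G at level 98, H at level 99,
   format "{ 'pogmorphism'  G  ->  H }") : type_scope.

Section POGroupCategory.
Variables (G H K : poGroupType).
Variables (f : {pogmorphism G -> H}) (g : {pogmorphism H -> K}).
HB.instance Definition _ := Order.OrderMorphism.on (@idfun G).
HB.instance Definition _ := Order.OrderMorphism.on (g \o f).
End POGroupCategory.

(* Every subgroup containing the positive cone is the whole group. *)
Definition directed (G : poGroupType) : Prop :=
  forall S : {pred G}, zmod_closed S -> (forall x, 0 <= x -> x \in S) ->
  forall x, x \in S.

Definition unperforated (G : poGroupType) : Prop :=
  forall (x : G) (n : nat), (0 < n)%N -> 0 <= x *+ n -> 0 <= x.

Definition has_interpolation (G : poGroupType) : Prop :=
  forall x1 x2 y1 y2 : G,
    x1 <= y1 -> x1 <= y2 -> x2 <= y1 -> x2 <= y2 ->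
  exists z : G, [/\ x1 <= z, x2 <= z, z <= y1 & z <= y2].

HB.mixin Record POGroup_isDimGroup G of POGroup G := {
  dimg_directed : directed G;
  dimg_unperforated : unperforated G;
  dimg_interpolation : has_interpolation G
}.

#[short(type="dimGroupType")]
HB.structure Definition DimGroup := { G of POGroup_isDimGroup G & POGroup G }.

Definition dimg_isomorphic (D E : dimGroupType) : Prop :=
  exists (f : {pogmorphism D -> E}) (g : {pogmorphism E -> D}),
    cancel f g /\ cancel g f.

Definition simplicial (r : nat) : Type := 'rV[int]_r.

Section Simplicial.
Variable r : nat.
Implicit Types x y z t : simplicial r.

HB.instance Definition _ := GRing.Zmodule.on (simplicial r).

Definition simplicial_le x y : bool := [forall j, x 0 j <= y 0 j].

Lemma simplicial_leP x y :
  reflect (forall j, x 0 j <= y 0 j) (simplicial_le x y).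
Proof. exact: forallP. Qed.

Fact simplicial_le_refl : reflexive simplicial_le.
Proof. by move=> x; apply/simplicial_leP. Qed.

Fact simplicial_le_anti : antisymmetric simplicial_le.
Proof.
move=> x y /andP[/simplicial_leP xy /simplicial_leP yx].
by apply/rowP => j; apply/le_anti; rewrite xy yx.
Qed.

Fact simplicial_le_trans : transitive simplicial_le.
Proof.
move=> y x z /simplicial_leP xy /simplicial_leP yz.
by apply/simplicial_leP => j; apply: le_trans (xy j) (yz j).
Qed.

HB.instance Definition _ :=
  Order.Le_isPOrder.Build ring_display (simplicial r)
    simplicial_le_refl simplicial_le_anti simplicial_le_trans.

Lemma le_simplicialP x y : reflect (forall j, x 0 j <= y 0 j) (x <= y).
Proof. exact: simplicial_leP. Qed.

Fact simplicial_translate x y t : x <= y -> x + t <= y + t.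
Proof.
by move=> /le_simplicialP xy; apply/le_simplicialP => j; rewrite !mxE lerD2r.
Qed.

HB.instance Definition _ :=
  POrderedZmodule_isPOGroup.Build (simplicial r) simplicial_translate.

Fact simplicial_directed : directed (simplicial r).
Proof.
move=> S [S0 SB] Spos x.
pose p : simplicial r := \row_j Num.max (x 0 j) 0.
have -> : x = p - (p - x) by rewrite opprB addrC subrK.
by apply: SB; apply: Spos; apply/le_simplicialP => j;
  rewrite !mxE ?subr_ge0 le_max lexx ?orbT.
Qed.

Fact simplicial_unperforated : unperforated (simplicial r).
Proof.
move=> x n n_gt0 /le_simplicialP xn; apply/le_simplicialP => j.
by have := xn j; rewrite !mxE mulmxnE pmulrn_lge0.
Qed.

Fact simplicial_interpolation : has_interpolation (simplicial r).
Proof.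
move=> x1 x2 y1 y2 /le_simplicialP h11 /le_simplicialP h12.
move=> /le_simplicialP h21 /le_simplicialP h22.
exists (\row_j Num.max (x1 0 j) (x2 0 j)).
split; apply/le_simplicialP => j; rewrite !mxE.
- by rewrite le_max lexx.
- by rewrite le_max lexx orbT.
- by rewrite ge_max h11 h21.
- by rewrite ge_max h12 h22.
Qed.

HB.instance Definition _ := POGroup_isDimGroup.Build (simplicial r)
  simplicial_directed simplicial_unperforated simplicial_interpolation.

End Simplicial.

(* Indexed from 0: term n here is term n + 1 of a sequence indexed by the
   positive integers. *)
Record dimSequence := DimSequence {
  seq_obj :> nat -> dimGroupType;
  seq_map : forall i, {pogmorphism seq_obj i -> seq_obj i.+1}
}.

Section Transition.
Variable A : dimSequence.

Fixpoint seq_iter (i n : nat) : A i -> A (n + i)%N :=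
  if n is n'.+1 then fun x => seq_map A (n' + i) (seq_iter n' x) else id.

(* The composite A_i -> A_j; the cast is along (j - i) + i = j. *)
Definition seq_trans (i j : nat) (ij : (i < j)%N) (x : A i) : A j :=
  ecast k (A k) (subnK (ltnW ij)) (seq_iter (j - i) x).

End Transition.

Definition is_cocone (A : dimSequence) (D : dimGroupType)
    (c : forall i, {pogmorphism A i -> D}) : Prop :=
  forall i (x : A i), c i.+1 (seq_map A i x) = c i x.

Definition is_colimit (A : dimSequence) (D : dimGroupType)
    (c : forall i, {pogmorphism A i -> D}) : Prop :=
  is_cocone c /\
  forall (T : dimGroupType) (t : forall i, {pogmorphism A i -> T}),
    is_cocone t ->
  exists2 u : {pogmorphism D -> T}, forall i x, u (c i x) = t i x
    & forall v : {pogmorphism D -> T},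
        (forall i x, v (c i x) = t i x) -> v =1 u.

(* Colimits being unique up to isomorphism, the choice of D and E is
   irrelevant. *)
Definition isomorphic_colimits (A B : dimSequence) : Prop :=
  exists (D : dimGroupType) (c : forall i, {pogmorphism A i -> D})
         (E : dimGroupType) (e : forall k, {pogmorphism B k -> E}),
    [/\ is_colimit c, is_colimit e & dimg_isomorphic D E].

Definition confluent (A B : dimSequence) : Prop :=
  exists (i k : nat -> nat)
         (i_lt : forall n, (i n < i n.+1)%N) (k_lt : forall n, (k n < k n.+1)%N)
         (f : forall n, {pogmorphism A (i n) -> B (k n)})
         (g : forall n, {pogmorphism B (k n) -> A (i n.+1)}),
    (forall n x, seq_trans (i_lt n) x = g n (f n x)) /\
    (forall n x, seq_trans (k_lt n) x = f n.+1 (g n x)).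

(* Main.v *)
(** Two sequences with isomorphic colimits are intertwined back and forth: a
    positive map from [Z^r] to the colimit is determined by the images of the
    [r] basis vectors, which all come from the positive cone of a single finite
    stage, so the map lifts to that stage; the triangles, which commute in the
    colimit, commute on the basis vectors at some later stage.  Both facts
    hold because the universal colimit is the algebraic one, with the images of
    the positive elements of all stages as its cone.  Conversely a
    confluence presents each colimit as the target of a compatible family on a
    cofinal subsequence of the other one. *)
Require Import Defs.
From HB Require Import structures.
From mathcomp Require Import all_boot all_order all_algebra.
From mathcomp Require Import boolp.

Set Implicit Arguments.
Unset Strict Implicit.
Unset Printing Implicit Defensive.

Import Order.TTheory GRing.Theory Num.Theory.

Local Open Scope ring_scope.
Local Open Scope quotient_scope.

(** * Ordered groups and positive homomorphisms *)

Section POGroupTheory.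
Variables G H : poGroupType.

Lemma pog_subr_ge0 (x y : G) : (0 <= y - x) = (x <= y).
Proof.
apply/idP/idP => [/(@pog_translate G _ _ x)|/(@pog_translate G _ _ (- x))].
  by rewrite add0r subrK.
by rewrite subrr.
Qed.

Lemma pog_addr_ge0 (x y : G) : 0 <= x -> 0 <= y -> 0 <= x + y.
Proof.
move=> x0 /(@pog_translate G _ _ x); rewrite add0r addrC.
exact: le_trans.
Qed.

Lemma pog_mulrz_ge0 (x : G) (m : int) : 0 <= x -> 0 <= m -> 0 <= x *~ m.
Proof.
case: m => // n x0 _; rewrite -pmulrn.
by elim: n => [|n IHn]; rewrite ?mulr0n // mulrS pog_addr_ge0.
Qed.

Lemma pog_sum_ge0 (I : Type) (s : seq I) (F : I -> G) :
  (forall i, 0 <= F i) -> 0 <= \sum_(i <- s) F i.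
Proof.
by move=> F0; elim/big_ind: _ => // x y; apply: pog_addr_ge0.
Qed.

Lemma ler_pogmorph (f : {pogmorphism G -> H}) : {homo f : x y / x <= y}.
Proof. exact: omorph_le. Qed.

Lemma pogmorph_ge0 (f : {pogmorphism G -> H}) x : 0 <= x -> 0 <= f x.
Proof. by move/(ler_pogmorph f); rewrite raddf0. Qed.

End POGroupTheory.

Section PositiveMorphism.
Variables (G H : poGroupType) (f : G -> H).
Hypothesis fD : {morph f : x y / x + y}.
Hypothesis f_ge0 : forall x, 0 <= x -> 0 <= f x.

(** The two proofs are phantom arguments: instances declared on this alias of [f] recover them by
    unification. *)
Definition positive_map & {morph f : x y / x + y}
  & (forall x, 0 <= x -> 0 <= f x) := f.

Local Notation pf := (positive_map fD f_ge0).

Fact positive_map_additive : nmod_morphism pf.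
Proof.
split; last exact: fD.
by apply: (addrI (f 0)); rewrite /positive_map -fD !addr0.
Qed.

HB.instance Definition _ :=
  GRing.isNmodMorphism.Build G H pf positive_map_additive.

Fact positive_map_homo : {homo pf : x y / x <= y}.
Proof.
move=> x y; rewrite -pog_subr_ge0 => /f_ge0.
by rewrite -/(pf _) raddfB pog_subr_ge0.
Qed.

HB.instance Definition _ :=
  Order.isOrderMorphism.Build ring_display G ring_display H
    pf positive_map_homo.

Lemma exists_pogmorphism : exists g : {pogmorphism G -> H}, g =1 f.
Proof. by exists pf. Qed.

End PositiveMorphism.

(** * Transition maps between arbitrary stages *)

Section Push.
Variable A : dimSequence.

(* [seq_trans] extended to [i = j]; [seq_trans ij] is [push (ltnW ij)]
   by conversion. *)
Definition push (i j : nat) (ij : (i <= j)%N) (x : A i) : A j :=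
  ecast k (A k) (subnK ij) (seq_iter (j - i) x).

(** For a target of the form [n + i] the cast is along a loop in [nat], trivial by uniqueness of
    identity proofs. Later proofs reach this form by eliminating [subnK]. *)
Lemma push_iter i n (le : (i <= n + i)%N) (x : A i) :
  push le x = seq_iter n x.
Proof.
rewrite /push; move: (subnK le); set m := (_ - _)%N.
have -> : m = n by rewrite /m addnK.
by move=> E; rewrite eq_axiomK.
Qed.

Lemma push_refl i (le : (i <= i)%N) (x : A i) : push le x = x.
Proof. exact: (@push_iter i 0). Qed.

Lemma pushS i j (ij : (i <= j)%N) (ij1 : (i <= j.+1)%N) (x : A i) :
  push ij1 x = seq_map A j (push ij x).
Proof.
move: (ij) ij1; case: _ / (subnK ij) => {}ij ij1.
by rewrite push_iter (@push_iter i (_.+1)).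
Qed.

Lemma push_comp i j k (ij : (i <= j)%N) (jk : (j <= k)%N) (ik : (i <= k)%N)
  (x : A i) : push jk (push ij x) = push ik x.
Proof.
elim: k jk ik => [|k IHk] jk ik.
  case: j ij jk => // ij jk; rewrite push_refl; congr push.
  exact: bool_irrelevance.
have /predU1P[jE|jk'] : (j == k.+1) || (j < k.+1)%N by rewrite -leq_eqVlt.
  move: jk ik; rewrite -jE => jk ik.
  by rewrite push_refl; congr push; apply: bool_irrelevance.
rewrite ltnS in jk'; have ik' := leq_trans ij jk'.
by rewrite (pushS jk' jk) (pushS ik' ik) (IHk jk' ik').
Qed.

Lemma push_cocone (D : dimGroupType) (c : forall i, {pogmorphism A i -> D}) :
  is_cocone c ->
  forall i j (ij : (i <= j)%N) x, c j (push ij x) = c i x.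
Proof.
move=> cc i j ij x; move: (ij); case: _ / (subnK ij) => {}ij.
rewrite push_iter; elim: (_ - _)%N => //= n <-; exact: cc.
Qed.

Section PushMorphism.
Variables (i j : nat) (ij : (i <= j)%N).

Fact push_additive : nmod_morphism (push ij).
Proof.
move: (ij); case: _ / (subnK ij) => le; split=> [|x y]; rewrite !push_iter;
  elim: (_ - _)%N => //= n ->; by rewrite ?raddf0 ?raddfD.
Qed.

HB.instance Definition _ :=
  GRing.isNmodMorphism.Build (A i) (A j) (push ij) push_additive.

Fact push_homo : {homo push ij : x y / x <= y}.
Proof.
move: (ij); case: _ / (subnK ij) => le x y xy; rewrite !push_iter.
by elim: (_ - _)%N => //= n; apply: ler_pogmorph.
Qed.

HB.instance Definition _ :=
  Order.isOrderMorphism.Build ring_display (A i) ring_display (A j)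
    (push ij) push_homo.

End PushMorphism.
End Push.

(** * The algebraic colimit and its dimension group structure *)

Section Colimit.
Variable A : dimSequence.

Definition stage_elt := {i : nat & A i}.

(** [{eq_quot _}] takes a boolean relation, hence the classical [asbool]. *)
Definition eventually_eq (u v : stage_elt) : bool :=
  `[< exists n (un : (tag u <= n)%N) (vn : (tag v <= n)%N),
        push un (tagged u) = push vn (tagged v) >].

Fact eventually_eq_refl : reflexive eventually_eq.
Proof. by move=> u; apply/asboolP; exists (tag u), (leqnn _), (leqnn _). Qed.

Fact eventually_eq_sym : symmetric eventually_eq.
Proof.
by move=> u v; apply/asboolP/asboolP => -[n [un [vn E]]]; exists n, vn, un.
Qed.

Fact eventually_eq_trans : transitive eventually_eq.
Proof.
move=> v u w /asboolP[n [un [vn E]]] /asboolP[m [vm [wm E']]].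
apply/asboolP; exists (maxn n m).
have nM := leq_maxl n m; have mM := leq_maxr n m.
exists (leq_trans un nM), (leq_trans wm mM).
rewrite -(push_comp un nM) E -(push_comp wm mM) -E'.
by rewrite !(push_comp _ _ (leq_trans vn nM)).
Qed.

Canonical eventually_eq_equiv :=
  EquivRel eventually_eq eventually_eq_refl eventually_eq_sym
    eventually_eq_trans.

Definition colim := {eq_quot eventually_eq}.

HB.instance Definition _ := Choice.on colim.

Definition to_colim i (x : A i) : colim :=
  \pi_colim (Tagged (fun i => A i : Type) x).

Lemma to_colim_eqP i j (x : A i) (y : A j) :
  to_colim x = to_colim y <->
  exists n (xn : (i <= n)%N) (yn : (j <= n)%N), push xn x = push yn y.
Proof.
split=> [/eqP|H]; first by rewrite eqmodE => /asboolP.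
by apply/eqP; rewrite eqmodE; apply/asboolP.
Qed.

Lemma to_colim_push i j (ij : (i <= j)%N) (x : A i) :
  to_colim (push ij x) = to_colim x.
Proof. by apply/to_colim_eqP; exists j, (leqnn j), ij; rewrite push_refl. Qed.

Lemma to_colim_eq i (x y : A i) :
  to_colim x = to_colim y <->
  exists n (le : (i <= n)%N), push le x = push le y.
Proof.
split=> [/to_colim_eqP[n [xn [yn E]]]|[n [le E]]].
  by exists n, xn; rewrite E; congr push; apply: bool_irrelevance.
by apply/to_colim_eqP; exists n, le, le.
Qed.

Lemma to_colim_surj (u : colim) : exists i (x : A i), u = to_colim x.
Proof.
exists (tag (repr u)), (tagged (repr u)).
by rewrite /to_colim -[LHS]reprK; case: (repr u).
Qed.

Lemma to_colim_surj_ge n (u : colim) :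
  exists i (x : A i), (n <= i)%N /\ u = to_colim x.
Proof.
have [i [x ->]] := to_colim_surj u.
exists (maxn n i), (push (leq_maxr n i) x).
by rewrite leq_maxl to_colim_push.
Qed.

Lemma to_colim_surj2 (u v : colim) :
  exists i (x y : A i), u = to_colim x /\ v = to_colim y.
Proof.
have [i [x ->]] := to_colim_surj u.
have [j [y [ij ->]]] := to_colim_surj_ge i v.
by exists j, (push ij x), y; rewrite to_colim_push.
Qed.

Lemma to_colim_surj3 (u v w : colim) :
  exists i (x y z : A i),
    [/\ u = to_colim x, v = to_colim y & w = to_colim z].
Proof.
have [i [x [y [-> ->]]]] := to_colim_surj2 u v.
have [j [z [ij ->]]] := to_colim_surj_ge i w.
by exists j, (push ij x), (push ij y), z; rewrite !to_colim_push.
Qed.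

Definition colim_add (u v : colim) : colim :=
  to_colim (push (leq_maxl _ (tag (repr v))) (tagged (repr u))
            + push (leq_maxr (tag (repr u)) _) (tagged (repr v))).

Definition colim_opp (u : colim) : colim := to_colim (- tagged (repr u)).

(** By translation invariance in the stages, the positive cone of this order is the union of the
    images of the positive cones of the stages. *)
Definition colim_le (u v : colim) : bool :=
  `[< exists i (x y : A i), [/\ u = to_colim x, v = to_colim y & x <= y] >].

Lemma to_colim_repr (u : colim) : to_colim (tagged (repr u)) = u.
Proof. by rewrite /to_colim -[RHS]reprK; case: (repr u). Qed.

(** Addition does not depend on the representatives: those picked by [repr] agree with [x] and [y]
    only from stages [m] and [n] on, so the sums are compared at a stage [q] beyond all indices
    involved. *)
Lemma to_colimD i (x y : A i) :
  colim_add (to_colim x) (to_colim y) = to_colim (x + y).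
Proof.
rewrite /colim_add.
have := to_colim_repr (to_colim x); have := to_colim_repr (to_colim y).
case: (repr (to_colim x)) (repr (to_colim y)) => a x' [b y'] /=.
move=> /to_colim_eqP[n [bn [jn Ey]]] /to_colim_eqP[m [am [im Ex]]].
set p := maxn a b; set q := maxn p (maxn n m).
have pq : (p <= q)%N by apply: leq_maxl.
have nq : (n <= q)%N by rewrite /q !leq_max leqnn /= orbT.
have mq : (m <= q)%N by rewrite /q !leq_max leqnn !orbT.
apply/to_colim_eqP; exists q, pq, (leq_trans jn nq).
rewrite !raddfD /=; congr (_ + _).
  rewrite (push_comp _ _ (leq_trans am mq)) -(push_comp am mq) Ex.
  exact: push_comp.
rewrite (push_comp _ _ (leq_trans bn nq)) -(push_comp bn nq) Ey.
exact: push_comp.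
Qed.

Lemma to_colimN i (x : A i) : colim_opp (to_colim x) = to_colim (- x).
Proof.
rewrite /colim_opp; have := to_colim_repr (to_colim x).
case: (repr (to_colim x)) => a x' /= /to_colim_eqP[n [an [n_ E]]].
by apply/to_colim_eqP; exists n, an, n_; rewrite !raddfN /= E.
Qed.

Lemma to_colim0 i : to_colim (0 : A i) = to_colim (0 : A 0).
Proof. by rewrite -(to_colim_push (leq0n i)) raddf0. Qed.

Fact colim_addA : associative colim_add.
Proof.
move=> u v w; have [i [x [y [z [-> -> ->]]]]] := to_colim_surj3 u v w.
by rewrite !to_colimD addrA.
Qed.

Fact colim_addC : commutative colim_add.
Proof.
move=> u v; have [i [x [y [-> ->]]]] := to_colim_surj2 u v.
by rewrite !to_colimD addrC.
Qed.

Fact colim_add0 : left_id (to_colim (0 : A 0)) colim_add.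
Proof.
move=> u; have [i [x ->]] := to_colim_surj u.
by rewrite -(to_colim0 i) to_colimD add0r.
Qed.

Fact colim_addN : left_inverse (to_colim (0 : A 0)) colim_opp colim_add.
Proof.
move=> u; have [i [x ->]] := to_colim_surj u.
by rewrite to_colimN to_colimD addNr to_colim0.
Qed.

HB.instance Definition _ :=
  GRing.isZmodule.Build colim colim_addA colim_addC colim_add0 colim_addN.

Fact to_colim_additive i : nmod_morphism (@to_colim i).
Proof. by split=> [|x y]; [apply: to_colim0 | rewrite -to_colimD]. Qed.

HB.instance Definition _ i :=
  GRing.isNmodMorphism.Build (A i) colim (@to_colim i) (to_colim_additive i).

(** The ordered representatives given by [colim_le] may differ from [x] and [y], but agree with them
    from some stage on, and transition maps preserve the inequality. *)
Lemma to_colim_leP i (x y : A i) :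
  colim_le (to_colim x) (to_colim y) <->
  exists n (le : (i <= n)%N), push le x <= push le y.
Proof.
split=> [/asboolP[j [x' [y' [Ex Ey xy]]]]|[n [le xy]]]; last first.
  by apply/asboolP; exists n, (push le x), (push le y); rewrite !to_colim_push.
move/to_colim_eqP: Ex => [n [in_ [jn Ex]]].
move/to_colim_eqP: Ey => [m [im [jm Ey]]].
have nM := leq_maxl n m; have mM := leq_maxr n m.
exists (maxn n m), (leq_trans in_ nM).
rewrite -{1}(push_comp in_ nM) Ex -(push_comp im mM) Ey.
by rewrite !(push_comp _ _ (leq_trans jn nM)) push_homo.
Qed.

Fact colim_le_refl : reflexive colim_le.
Proof.
move=> u; have [i [x ->]] := to_colim_surj u.
by apply/asboolP; exists i, x, x.
Qed.

Fact colim_le_anti : antisymmetric colim_le.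
Proof.
move=> u v; have [i [x [y [-> ->]]]] := to_colim_surj2 u v.
move=> /andP[/to_colim_leP[n [in_ xy]] /to_colim_leP[m [im yx]]].
have nM := leq_maxl n m; have mM := leq_maxr n m.
apply/to_colim_eq; exists (maxn n m), (leq_trans in_ nM); apply/le_anti.
rewrite -!(push_comp in_ nM) (push_homo nM xy) /=.
by rewrite !(push_comp _ _ (leq_trans im mM)) -!(push_comp im mM) push_homo.
Qed.

Fact colim_le_trans : transitive colim_le.
Proof.
move=> v u w; have [i [x [y [z [-> -> ->]]]]] := to_colim_surj3 u v w.
move=> /to_colim_leP[n [in_ xy]] /to_colim_leP[m [im yz]].
have nM := leq_maxl n m; have mM := leq_maxr n m.
apply/to_colim_leP; exists (maxn n m), (leq_trans in_ nM).
rewrite -!(push_comp in_ nM); apply: le_trans (push_homo nM xy) _.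
by rewrite !(push_comp _ _ (leq_trans im mM)) -!(push_comp im mM) push_homo.
Qed.

HB.instance Definition _ :=
  Order.Le_isPOrder.Build ring_display colim
    colim_le_refl colim_le_anti colim_le_trans.

Lemma le_to_colimP i (x y : A i) :
  to_colim x <= to_colim y <->
  exists n (le : (i <= n)%N), push le x <= push le y.
Proof. exact: to_colim_leP. Qed.

Fact colim_translate (u v w : colim) : u <= v -> u + w <= v + w.
Proof.
have [i [x [y [z [-> -> ->]]]]] := to_colim_surj3 u v w.
move=> /le_to_colimP[n [le xy]]; rewrite -!raddfD.
apply/le_to_colimP; exists n, le; rewrite !raddfD; exact: pog_translate.
Qed.

HB.instance Definition _ :=
  POrderedZmodule_isPOGroup.Build colim colim_translate.

Lemma ge0_to_colimP i (x : A i) :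
  0 <= to_colim x <-> exists n (le : (i <= n)%N), 0 <= push le x.
Proof.
rewrite -(raddf0 (@to_colim i)) le_to_colimP.
by split=> -[n [le x0]]; exists n, le; rewrite ?raddf0 // -(raddf0 (push le)).
Qed.

Fact to_colim_homo i : {homo @to_colim i : x y / x <= y}.
Proof.
by move=> x y xy; apply/le_to_colimP; exists i, (leqnn i); apply: push_homo.
Qed.

HB.instance Definition _ i :=
  Order.isOrderMorphism.Build ring_display (A i) ring_display colim
    (@to_colim i) (@to_colim_homo i).

(** The preimage of [S] in the stage where [u] lives is a subgroup containing the positive cone of
    that stage, hence everything. *)
Fact colim_directed : directed colim.
Proof.
move=> S [S0 SB] Spos u; have [i [x ->]] := to_colim_surj u.
apply: (@dimg_directed (A i) [pred y | to_colim y \in S]).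
  split=> [|y z]; rewrite !inE ?raddf0 // => Sy Sz.
  by rewrite raddfB; apply: SB.
by move=> y y0; apply: Spos; apply: pogmorph_ge0.
Qed.

Fact colim_unperforated : unperforated colim.
Proof.
move=> u n n0; have [i [x ->]] := to_colim_surj u.
rewrite -raddfMn => /ge0_to_colimP[m [le]]; rewrite raddfMn.
by move=> /(dimg_unperforated _ _ n0) x0; apply/ge0_to_colimP; exists m, le.
Qed.

(** The four elements live at one stage and the four inequalities hold together at a later one;
    interpolate there and map the result to the colimit. *)
Fact colim_interpolation : has_interpolation colim.
Proof.
move=> u1 u2 v1 v2.
have [i0 [x1 [x2 [x3 [-> -> ->]]]]] := to_colim_surj3 u1 u2 v1.
have [i [x4 [le0 ->]]] := to_colim_surj_ge i0 v2.
rewrite -(to_colim_push le0 x1) -(to_colim_push le0 x2) -(to_colim_push le0 x3).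
move: (push le0 x1) (push le0 x2) (push le0 x3) => {i0 le0 x1 x2 x3} x1 x2 x3.
move=> /le_to_colimP[a [ia H13]] /le_to_colimP[b [ib H14]].
move=> /le_to_colimP[c [ic H23]] /le_to_colimP[d [id H24]].
set n := maxn (maxn a b) (maxn c d).
have an : (a <= n)%N by rewrite /n !leq_max leqnn.
have bn : (b <= n)%N by rewrite /n !leq_max leqnn !orbT.
have cn : (c <= n)%N by rewrite /n !leq_max leqnn !orbT.
have dn : (d <= n)%N by rewrite /n !leq_max leqnn !orbT.
have in_ := leq_trans ia an.
have mono m (im : (i <= m)%N) (mn : (m <= n)%N) (x y : A i) :
    push im x <= push im y -> push in_ x <= push in_ y.
  by move=> /(push_homo mn); rewrite !(push_comp _ _ in_).
have [z [z1 z2 z3 z4]] := dimg_interpolation _ _ _ _ (mono _ _ an _ _ H13)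
  (mono _ _ bn _ _ H14) (mono _ _ cn _ _ H23) (mono _ _ dn _ _ H24).
exists (to_colim z).
by split; [rewrite -(to_colim_push in_ x1) | rewrite -(to_colim_push in_ x2)
  | rewrite -(to_colim_push in_ x3) | rewrite -(to_colim_push in_ x4)];
  apply: to_colim_homo.
Qed.

HB.instance Definition _ := POGroup_isDimGroup.Build colim
  colim_directed colim_unperforated colim_interpolation.

Definition colim_map i : {pogmorphism A i -> colim} := @to_colim i.

Lemma to_colim_cocone : is_cocone colim_map.
Proof.
move=> i x; rewrite /= -(to_colim_push (leqnSn i)).
by rewrite (pushS (leqnn i)) push_refl.
Qed.

(** Serves twice: the identity subsequence gives the universal property, and the subsequences of a
    confluence give the comparison maps. *)
Lemma colim_cofinal (T : dimGroupType) (i : nat -> nat)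
    (i_lt : forall n, (i n < i n.+1)%N)
    (t : forall n, {pogmorphism A (i n) -> T}) :
  (forall n x, t n.+1 (seq_trans (i_lt n) x) = t n x) ->
  exists u : {pogmorphism colim -> T},
    forall n x, u (colim_map (i n) x) = t n x.
Proof.
move=> tE.
have i_homo : {homo i : m n / (m <= n)%N}.
  exact: (homo_leq (@leqnn) leq_trans (fun n => ltnW (i_lt n))).
have i_ge n : (n <= i n)%N by elim: n => // n /leq_ltn_trans; apply.
have tpush m n (mn : (m <= n)%N) x : t n (push (i_homo _ _ mn) x) = t m x.
  elim: n mn => [|n IHn] mn.
    by case: m mn x => // mn x; rewrite push_refl.
  have /predU1P[mE|mn'] : (m == n.+1) || (m < n.+1)%N by rewrite -leq_eqVlt.
    by case: _ / mE mn => mn; rewrite push_refl.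
  by rewrite -(push_comp (i_homo _ _ (mn' : (m <= n)%N)) (ltnW (i_lt n)))
    tE IHn.
(* A representative at stage [a] is moved to stage [i a], available because [a <= i a]. *)
pose u (d : colim) : T := t _ (push (i_ge _) (tagged (repr d))).
(* The representative and [x] become equal at stage [m]; both values of [t] are moved to index
   [maxn a (maxn m n)], whose stage lies beyond [m]. *)
have uE n x : u (to_colim x) = t n x.
  rewrite /u; have := to_colim_repr (to_colim x).
  case: (repr (to_colim x)) => a x' /= /to_colim_eqP[m [am [im E]]].
  have aM := leq_maxl a (maxn m n).
  have mM : (m <= maxn a (maxn m n))%N by rewrite !leq_max leqnn orbT.
  have nM : (n <= maxn a (maxn m n))%N by rewrite !leq_max leqnn !orbT.
  have mi := leq_trans mM (i_ge _).
  rewrite -(tpush _ _ aM) -(tpush _ _ nM).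
  rewrite (push_comp _ _ (leq_trans am mi)) -(push_comp am mi) E.
  by congr (t _ _); apply: push_comp.
have surj2 (d d' : colim) : exists n (x y : A (i n)),
    d = to_colim x /\ d' = to_colim y.
  have [m [x [y [-> ->]]]] := to_colim_surj2 d d'.
  by exists m, (push (i_ge m) x), (push (i_ge m) y); rewrite !to_colim_push.
have uD : {morph u : d d' / d + d'}.
  move=> d d'; have [n [x [y [-> ->]]]] := surj2 d d'.
  by rewrite -raddfD !uE raddfD.
have u_ge0 d : 0 <= d -> 0 <= u d.
  have [m [x ->]] := to_colim_surj d.
  move=> /ge0_to_colimP[n [mn x0]]; rewrite -(to_colim_push mn).
  rewrite -(to_colim_push (i_ge n)) uE.
  by apply/pogmorph_ge0/pogmorph_ge0.
have [v vE] := exists_pogmorphism uD u_ge0.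
by exists v => n x; rewrite vE uE.
Qed.

Lemma colim_is_colimit : is_colimit colim_map.
Proof.
split=> [|T t tE]; first exact: to_colim_cocone.
have [//|u uE] := @colim_cofinal T id (fun n => ltnSn n) t.
  by move=> n x; apply: (push_cocone tE).
exists u => // v vE d; have [i [x ->]] := to_colim_surj d.
by rewrite vE uE.
Qed.

End Colimit.

(** * Transfer to an arbitrary colimit *)

Section ColimitTheory.
Variables (A : dimSequence) (D : dimGroupType).
Variable c : forall i, {pogmorphism A i -> D}.
Hypothesis c_colim : is_colimit c.

Lemma colimit_push i j (ij : (i <= j)%N) x : c j (push ij x) = c i x.
Proof. exact: push_cocone c_colim.1 _ _ _ _. Qed.

(** The universal properties give [u] to [colim A] and [v] back. Uniqueness forces [v \o u] to be
    the identity, so surjectivity of the stages onto [colim A] passes to [D]. *)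
Lemma colimit_to_colim :
  exists2 u : {pogmorphism D -> colim A}, forall i x, u (c i x) = to_colim x
    & forall d, exists i (x : A i), d = c i x.
Proof.
have [cc cU] := c_colim.
have [u uE _] := cU _ _ (@to_colim_cocone A).
have [v vE _] := (colim_is_colimit A).2 _ _ cc.
exists u => [//|d].
(* Both [v \o u] and [idfun] factor the cocone [c] through itself, so both equal [w]. *)
have [w _ wU] := cU _ _ cc.
have vu : v (u d) = w d.
  by apply: (wU (v \o u)) => j y /=; rewrite uE; apply: vE.
have -> : d = v (u d) by rewrite vu -(wU idfun).
have [i [x ->]] := to_colim_surj (u d).
by exists i, x; apply: vE.
Qed.

Lemma colimit_eq i (x y : A i) :
  c i x = c i y -> exists n (le : (i <= n)%N), push le x = push le y.
Proof.
by have [u uE _] := colimit_to_colim; move/(congr1 u);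
  rewrite !uE => /to_colim_eq.
Qed.

(** Positivity is carried by [u] to [colim A], where it is witnessed at a finite stage; pushing the
    representative there leaves its image in [D] unchanged. *)
Lemma colimit_ge0 (d : D) : 0 <= d -> exists i (x : A i), d = c i x /\ 0 <= x.
Proof.
have [u uE /(_ d)[i [x ->]]] := colimit_to_colim => /(pogmorph_ge0 u).
rewrite uE => /ge0_to_colimP[n [le x0]].
by exists n, (push le x); rewrite colimit_push.
Qed.

End ColimitTheory.

(** The strict bound [m < j] is what later makes the indices of a confluence strictly increasing. *)
Lemma fin_eventually (I : finType) (P : I -> nat -> Prop) (m : nat) :
  (forall i j k, (j <= k)%N -> P i j -> P i k) ->
  (forall i, exists j, P i j) -> exists2 j, (m < j)%N & forall i, P i j.
Proof.
move=> Pmono /choice[n nP]; exists (maxn m.+1 (\max_i n i)).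
  exact: leq_maxl.
by move=> i; apply: Pmono (nP i); rewrite leq_max leq_bigmax orbT.
Qed.

(** * Morphisms out of simplicial groups *)

Section Simplicial.
Variable r : nat.

Definition basis (j : 'I_r) : simplicial r := delta_mx 0 j.

Lemma basis_ge0 j : 0 <= basis j.
Proof. by apply/le_simplicialP => k; rewrite !mxE eqxx /=; case: eqP. Qed.

Lemma simplicial_sum_basis (x : simplicial r) :
  x = \sum_j basis j *~ x 0 j.
Proof.
rewrite [LHS]row_sum_delta; apply: eq_bigr => j _.
by rewrite -[x 0 j in LHS]intz scaler_int.
Qed.

Lemma eq_on_basis (G : poGroupType) (f g : {pogmorphism simplicial r -> G}) :
  (forall j, f (basis j) = g (basis j)) -> f =1 g.
Proof.
move=> fg x; rewrite (simplicial_sum_basis x) !raddf_sum.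
by apply: eq_bigr => j _; rewrite !raddfMz; congr (_ *~ _); apply: fg.
Qed.

(** The group is free on the basis, and its cone consists of the combinations with nonnegative
    coefficients. *)
Lemma simplicial_pogmorphism (G : poGroupType) (y : 'I_r -> G) :
  (forall j, 0 <= y j) ->
  exists f : {pogmorphism simplicial r -> G}, forall j, f (basis j) = y j.
Proof.
move=> y0; pose f (x : simplicial r) := \sum_j y j *~ x 0 j.
have fD : {morph f : x y / x + y}.
  by move=> x x'; rewrite /f -big_split /=; apply: eq_bigr => j _;
    rewrite mxE mulrzDr.
have f0 x : 0 <= x -> 0 <= f x.
  move=> /le_simplicialP x0; apply: pog_sum_ge0 => j.
  apply: pog_mulrz_ge0 => //.
  by have := x0 j; rewrite mxE.
have [g gE] := exists_pogmorphism fD f0.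
exists g => j; rewrite gE /f (bigD1 j) //= big1 ?addr0 ?mxE ?eqxx //.
by move=> k kj; rewrite mxE eqxx (negPf kj).
Qed.

Variables (B : dimSequence) (E : dimGroupType).
Variable e : forall k, {pogmorphism B k -> E}.
Hypothesis e_colim : is_colimit e.

Lemma simplicial_lift (t : {pogmorphism simplicial r -> E}) (m : nat) :
  exists2 k, (m < k)%N &
    exists f : {pogmorphism simplicial r -> B k}, forall x, e k (f x) = t x.
Proof.
(* Positivity of [y] belongs to the predicate because the lift must preserve the order. *)
have [|j|k mk] := @fin_eventually 'I_r
  (fun j k => exists y : B k, t (basis j) = e k y /\ 0 <= y) m.
- move=> j a b ab [y [tE y0]]; exists (push ab y).
  by rewrite (colimit_push e_colim) pogmorph_ge0.
- exact/(colimit_ge0 e_colim)/pogmorph_ge0/basis_ge0.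
move=> /choice[y yP]; exists k => //.
have [f fE] := simplicial_pogmorphism (fun j => (yP j).2).
exists f => x; apply: (eq_on_basis (f := e k \o f)) => j /=.
by rewrite fE -(yP j).1.
Qed.

Lemma simplicial_eventually_eq k (f g : {pogmorphism simplicial r -> B k}) :
  (forall x, e k (f x) = e k (g x)) ->
  exists n (kn : (k < n)%N), forall x, seq_trans kn (f x) = seq_trans kn (g x).
Proof.
move=> fg.
have [|j|n kn nP] := @fin_eventually 'I_r
  (fun j n => exists le : (k <= n)%N,
     push le (f (basis j)) = push le (g (basis j))) k.
- by move=> j a b ab [ka E']; exists (leq_trans ka ab);
    rewrite -!(push_comp ka ab) E'.
- by have [n [le E']] := colimit_eq e_colim (fg (basis j)); exists n, le.
exists n, kn => x.
apply: (eq_on_basis (f := push (ltnW kn) \o f) (g := push (ltnW kn) \o g)).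
move=> j; have [le E'] := nP j.
by rewrite /= (bool_irrelevance (ltnW kn) le).
Qed.

End Simplicial.

(** * From isomorphic colimits to a confluence and back *)

(** Lifting [t] to a stage [m] gives a triangle that commutes only in [D]; a further stage [n] makes
    it commute. In both uses [p] is the identity: it presents one term of an arbitrary sequence [A]
    as a simplicial group. *)
Lemma intertwining_step (A : dimSequence) (D : dimGroupType)
    (c : forall i, {pogmorphism A i -> D}) (r s i : nat)
    (p : {pogmorphism simplicial r -> A i})
    (f : {pogmorphism simplicial r -> simplicial s})
    (t : {pogmorphism simplicial s -> D}) :
  is_colimit c -> (forall x, t (f x) = c i (p x)) ->
  exists j (ij : (i < j)%N) (g : {pogmorphism simplicial s -> A j}),
    (forall y, c j (g y) = t y) /\ (forall x, seq_trans ij (p x) = g (f x)).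
Proof.
move=> c_colim tf; have [m im [g gE]] := simplicial_lift c_colim t i.
have [|n [mn H]] := simplicial_eventually_eq c_colim
  (f := push (ltnW im) \o p) (g := g \o f).
  by move=> x /=; rewrite (colimit_push c_colim) gE tf.
exists n, (ltn_trans im mn), (push (ltnW mn) \o g); split=> [y|x] /=.
  by rewrite (colimit_push c_colim).
by rewrite -[RHS]H /=; symmetry; apply: push_comp.
Qed.

Lemma isomorphic_colimits_confluent (r s : nat -> nat)
    (h : forall i, {pogmorphism simplicial (r i) -> simplicial (r i.+1)})
    (l : forall k, {pogmorphism simplicial (s k) -> simplicial (s k.+1)}) :
  isomorphic_colimits (@DimSequence (fun i => simplicial (r i)) h)
                      (@DimSequence (fun k => simplicial (s k)) l) ->
  confluent (@DimSequence (fun i => simplicial (r i)) h)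
            (@DimSequence (fun k => simplicial (s k)) l).
Proof.
set A := DimSequence h; set B := DimSequence l.
move=> [D [c [E [e [c_colim e_colim [phi [psi [phiK psiK]]]]]]]].
(* A state is a map between stages lying over [phi]; this invariant allows the next lift. *)
pose state := {i : nat & {k : nat &
  {f : {pogmorphism simplicial (r i) -> simplicial (s k)}
    | forall x, e k (f x) = phi (c i x)}}}.
pose si (z : state) := tag z; pose sk (z : state) := tag (tagged z).
pose sf (z : state) : {pogmorphism A (si z) -> B (sk z)} :=
  sval (tagged (tagged z)).
(* One step goes back and forth: [g] lifts [psi \o e k], then [f'] lifts [phi \o c i'], each closing
   a triangle with the previous map. *)
have step (z : state) : exists (z' : state)
    (i_lt : (si z < si z')%N) (k_lt : (sk z < sk z')%N)
    (g : {pogmorphism B (sk z) -> A (si z')}),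
    (forall x, seq_trans i_lt x = g (sf z x)) /\
    (forall y, seq_trans k_lt y = sf z' (g y)).
  case: z => i [k [f fE]].
  have [|i' [i_lt [g [gE gf]]]] := @intertwining_step A D c _ _ i idfun f
    (psi \o e k) c_colim.
    by move=> x /=; rewrite fE phiK.
  have [|k' [k_lt [f' [f'E f'g]]]] := @intertwining_step B E e _ _ k idfun g
    (phi \o c i') e_colim.
    by move=> y /=; rewrite gE /= psiK.
  by exists (existT _ i' (existT _ k' (exist _ f' f'E))), i_lt, k_lt, g.
have [k0 _ [f0 f0E]] := simplicial_lift e_colim (phi \o c 0) 0.
have [next nextP] := choice step.
pose z n := iter n next (existT _ 0 (existT _ k0 (exist _ f0 f0E)) : state).
(* [cid] turns the existentials into sigma types, so that the index bounds and [g] can be projected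
   as functions of [n]. *)
have zP n : {i_lt : (si (z n) < si (z n.+1))%N &
    {k_lt : (sk (z n) < sk (z n.+1))%N &
    {g : {pogmorphism B (sk (z n)) -> A (si (z n.+1))} |
      (forall x, seq_trans i_lt x = g (sf (z n) x)) /\
      (forall y, seq_trans k_lt y = sf (z n.+1) (g y))}}}.
  by have /cid[i_lt /cid[k_lt /cid[g gP]]] := nextP (z n); exists i_lt, k_lt, g.
exists (fun n => si (z n)), (fun n => sk (z n)).
exists (fun n => tag (zP n)), (fun n => tag (tagged (zP n))).
exists (fun n => sf (z n)), (fun n => sval (tagged (tagged (zP n)))).
by split=> n x; case: (zP n) => i_lt [k_lt [g []]].
Qed.

Lemma confluent_isomorphic_colimits (A B : dimSequence) :
  confluent A B -> isomorphic_colimits A B.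
Proof.
move=> [i [k [i_lt [k_lt [f [g [gf fg]]]]]]].
have seq_transK (C : dimSequence) a b (ab : (a < b)%N) (x : C a) :
    colim_map C b (seq_trans ab x) = colim_map C a x.
  exact: to_colim_push.
(* Compatibility holds because [f n.+1] after the transition is [f n.+1 \o g n \o f n], that is, the
   transition of [B] after [f n]. *)
have [|phi phiE] := @colim_cofinal A (colim B) i i_lt
  (fun n => colim_map B (k n) \o f n).
  by move=> n x /=; rewrite gf -fg seq_transK.
have [|psi psiE] := @colim_cofinal B (colim A) k k_lt
  (fun n => colim_map A (i n.+1) \o g n).
  by move=> n y /=; rewrite fg -gf seq_transK.
exists (colim A), (colim_map A), (colim B), (colim_map B).
split; [exact: colim_is_colimit | exact: colim_is_colimit |].
(* Stages of a cofinal subsequence already cover the colimit, so both composites need checking only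
   there, where they are transition maps and hence invisible in the colimit. *)
have surj (C : dimSequence) (a : nat -> nat) :
    (forall n, (a n < a n.+1)%N) ->
    forall d : colim C, exists n (x : C (a n)), d = colim_map C (a n) x.
  move=> a_lt d; have [m [x ->]] := to_colim_surj d.
  have a_ge : (m <= a m)%N by elim: (m) => // n /leq_ltn_trans; apply.
  by exists m, (push a_ge x); rewrite /= to_colim_push.
exists phi, psi; split=> d.
  have [n [x ->]] := surj _ _ i_lt d.
  by rewrite phiE psiE /= -gf; apply: seq_transK.
have [n [y ->]] := surj _ _ k_lt d.
by rewrite psiE phiE /= -fg; apply: seq_transK.
Qed.

Theorem corollary3p6 (r s : nat -> nat)
    (h : forall i, {pogmorphism simplicial (r i) -> simplicial (r i.+1)})
    (l : forall k, {pogmorphism simplicial (s k) -> simplicial (s k.+1)}) :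
  isomorphic_colimits (@DimSequence (fun i => simplicial (r i)) h)
                      (@DimSequence (fun k => simplicial (s k)) l)
  <-> confluent (@DimSequence (fun i => simplicial (r i)) h)
                (@DimSequence (fun k => simplicial (s k)) l).
Proof.
split; first exact: isomorphic_colimits_confluent.
exact: confluent_isomorphic_colimits.
Qed.
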